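(* For any small category $\Lambda$ and any right $\Lambda$-module $\mathcal{A}$, the maps $\zeta^n:\operatorname{Hom}_\Lambda(P^n,\mathcal{A})\to\tilde{C}^n(\Lambda,\mathcal{A})$, $n\ge0$, given by $$(\zeta^nf)(\lambda_1,\dots,\lambda_n)=f([\lambda_1,\dots,\lambda_n,s(\lambda_n)])$$ (for $n=0$: $(\zeta^0f)(v)=f([v])$ for objects $v$) induce an isomorphism $H^*(\Lambda,\mathcal{A})\cong\tilde{H}^*(\Lambda,\mathcal{A})$ between the cohomology of $\Lambda$ with coefficients in $\mathcal{A}$ and the categorical cohomology of $\Lambda$ with coefficients in $\mathcal{A}$.
   Context: Categories are viewed arrows-only: $\lambda\in\Lambda$ means $\lambda$ is a morphism, with range $r(\lambda)$ and source $s(\lambda)$; objects are identified with identity morphisms; $\lambda\mu$ is defined when $s(\lambda)=r(\mu)$. A right $\Lambda$-module is a contravariant functor $\mathcal{A}:\Lambda\to\mathbf{Ab}$, with abelian groups $\mathcal{A}_v$ for objects $v$ and homomorphisms $\mathcal{A}(\lambda):\mathcal{A}_{r(\lambda)}\to\mathcal{A}_{s(\lambda)}$; morphisms are natural transformations, forming the abelian group $\operatorname{Hom}_\Lambda(\cdot,\cdot)$. For $n\ge1$, $\Lambda^{*n}$ is the set of $n$-tuples $(\lambda_1,\dots,\lambda_n)$ with $s(\lambda_i)=r(\lambda_{i+1})$; $\Lambda^{*0}=\operatorname{Obj}(\Lambda)$. $P^n$ is the $\Lambda$-module for which $P^n_v$ is the free abelian group on all $(\lambda_0,\dots,\lambda_n)\in\Lambda^{*(n+1)}$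 with $s(\lambda_n)=v$ (generators denoted $[\lambda_0,\dots,\lambda_n]$), and $P^n(\lambda)([\lambda_0,\dots,\lambda_n])=[\lambda_0,\dots,\lambda_{n-1},\lambda_n\lambda]$. For $n\ge1$, $d_n:P^n\to P^{n-1}$ is $$d_n([\lambda_0,\dots,\lambda_n])=[\lambda_1,\dots,\lambda_n]+\sum_{i=1}^n(-1)^i[\lambda_0,\dots,\lambda_{i-1}\lambda_i,\dots,\lambda_n].$$ $H^n(\Lambda,\mathcal{A})$ is the $n$th cohomology group of the complex $\operatorname{Hom}_\Lambda(P^*,\mathcal{A})$ with boundary maps $\delta_n(c)=c\circ d_{n+1}$. The categorical $n$-cochains are $\tilde{C}^n(\Lambda,\mathcal{A})=\{c:\Lambda^{*n}\to\bigsqcup_v\mathcal{A}_v\mid c(\lambda_1,\dots,\lambda_n)\in\mathcal{A}_{s(\lambda_n)}\}$ (for $n=0$, $c(v)\in\mathcal{A}_v$), with $\tilde{\delta}^n:\tilde{C}^n\to\tilde{C}^{n+1}$ given for $n\ge1$ by $$\tilde{\delta}^n(c)(\lambda_0,\dots,\lambda_n)=c(\lambda_1,\dots,\lambda_n)+\sum_{i=1}^n(-1)^ic(\lambda_0,\dots,\lambda_{i-1}\lambda_i,\dots,\lambda_n)+(-1)^{n-1}\mathcal{A}(\lambda_n)(c(\lambda_0,\dots,\lambda_{n-1})),$$ and $\tilde{\delta}^0(c)(\lambda)=c(s(\lambda))-\mathcal{A}(\lambda)(c(r(\lambda)))$. The categorical cohomology is $\tilde{H}^n(\Lambda,\mathcal{A})=\ker\tilde{\delta}^n/\operatorname{Im}\tilde{\delta}^{n-1}$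 (with $\operatorname{Im}\tilde{\delta}^{-1}=0$). *)

(* Defs.v *)
From HB Require Import structures.
From mathcomp Require Import all_boot all_order all_algebra.
From mathcomp Require Import boolp.
From mathcomp Require Import freeg.

Set Implicit Arguments.
Unset Strict Implicit.
Unset Printing Implicit Defensive.

Import GRing.Theory.
Local Open Scope ring_scope.
Local Open Scope quotient_scope.

Local Obligation Tactic := idtac.

Record cochainComplex := CochainComplex {
  coch :> nat -> zmodType;
  cdiff : forall n, coch n -> coch n.+1;
  cdiff_zmod_morphism : forall n, zmod_morphism (@cdiff n);
  cdiffK : forall n x, @cdiff n.+1 (@cdiff n x) = 0
}.

HB.instance Definition _ (K : cochainComplex) n :=
  GRing.isZmodMorphism.Build (K n) (K n.+1) (@cdiff K n)
    (cdiff_zmod_morphism (n := n)).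

Section Cohomology.
Variables (K : cochainComplex) (n : nat).

Definition cocycles : {pred K n} := [pred x | cdiff x == 0].

Fact cocycles_zmod_closed : zmod_closed cocycles.
Proof.
split=> [|x y]; rewrite !inE ?raddf0 // => /eqP dx /eqP dy.
by rewrite raddfB /= dx dy subrr.
Qed.

HB.instance Definition _ :=
  GRing.isZmodClosed.Build (K n) cocycles cocycles_zmod_closed.

Record cocycle := Cocycle { cocycle_val :> K n; _ : cocycle_val \in cocycles }.

HB.instance Definition _ := [isSub for cocycle_val].
HB.instance Definition _ := [Choice of cocycle by <:].
HB.instance Definition _ := [SubChoice_isSubZmodule of cocycle by <:].

End Cohomology.

Definition is_coboundary (K : cochainComplex) n : K n -> Prop :=
  match n with
  | 0 => fun x => x = 0
  | m.+1 => fun x => exists y : K m, cdiff y = x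
  end.

Definition coboundaries (K : cochainComplex) n : {pred cocycle K n} :=
  [pred x | `[< is_coboundary (cocycle_val x) >]].

Fact coboundaries_zmod_closed K n : zmod_closed (@coboundaries K n).
Proof.
split=> [|x y]; rewrite !inE.
  by apply/asboolP; case: n => [|n] //=; exists 0; rewrite raddf0.
move=> /asboolP dx /asboolP dy; apply/asboolP.
have -> : cocycle_val (x - y) = cocycle_val x - cocycle_val y :> K n.
  exact: (raddfB (val : cocycle K n -> K n)).
case: n x y dx dy => [|n] x y /=; first by move=> -> ->; rewrite subrr.
by move=> [x' <-] [y' <-]; exists (x' - y'); rewrite raddfB.
Qed.

HB.instance Definition _ K n :=
  GRing.isZmodClosed.Build (cocycle K n) (@coboundaries K n)
    (@coboundaries_zmod_closed K n).

Definition cohomology (K : cochainComplex) (n : nat) : zmodType :=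
  Quotient.quot (@coboundaries K n).

Definition cohomology_class (K : cochainComplex) (n : nat) (x : cocycle K n) :
  cohomology K n := \pi_(Quotient.quot (@coboundaries K n)) x.

(* The type [mor u v] is the set of morphisms with range u and source v, so   *)
(* that [comp f g] is the composite written fg, defined when s(f) = r(g).     *)

Record smallCategory := SmallCategory {
  obj :> Type;
  mor : obj -> obj -> Type;
  idm : forall v, mor v v;
  comp : forall u v w, mor u v -> mor v w -> mor u w;
  comp1m : forall u v (f : mor u v), comp (idm u) f = f;
  compm1 : forall u v (f : mor u v), comp f (idm v) = f;
  compA : forall u v w x (f : mor u v) (g : mor v w) (h : mor w x),
    comp f (comp g h) = comp (comp f g) h
}.

Record rmodule (L : smallCategory) := RModule {
  rmod_at :> L -> zmodType;
  act : forall u v, mor u v -> rmod_at u -> rmod_at v;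
  act_zmod_morphism : forall u v (f : mor u v), zmod_morphism (act f);
  act1 : forall v x, act (idm v) x = x;
  actM : forall u v w (f : mor u v) (g : mor v w) x,
    act (comp f g) x = act g (act f x)
}.

HB.instance Definition _ L (M : rmodule L) u v (f : mor u v) :=
  GRing.isZmodMorphism.Build (M u) (M v) (act f) (act_zmod_morphism f).

Record rhom (L : smallCategory) (M N : rmodule L) := RHom {
  rhom_at :> forall v, M v -> N v;
  rhom_zmod_morphism : forall v, zmod_morphism (@rhom_at v);
  rhom_natural : forall u v (f : mor u v) x,
    rhom_at (act f x) = act f (rhom_at x)
}.

HB.instance Definition _ L (M N : rmodule L) (f : rhom M N) v :=
  GRing.isZmodMorphism.Build (M v) (N v) (@rhom_at L M N f v)
    (rhom_zmod_morphism f (v := v)).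

Section RHomZmodule.
Variables (L : smallCategory) (M N : rmodule L).

Lemma rhomP (f g : rhom M N) : (forall v (x : M v), f v x = g v x) -> f = g.
Proof.
case: f g => [f fB fN] [g gB gN] /= fg.
have {}fg : f = g.
  by apply: functional_extensionality_dep => v;
     apply: functional_extensionality_dep => x.
by subst g; congr RHom; apply: Prop_irrelevance.
Qed.

Program Definition rhom0 : rhom M N := RHom (rhom_at := fun v _ => 0) _ _.
Next Obligation. by move=> v x y; rewrite /= subr0. Qed.
Next Obligation. by move=> u v f x; rewrite /= raddf0. Qed.

Program Definition rhom_opp (f : rhom M N) : rhom M N :=
  RHom (rhom_at := fun v x => - f v x) _ _.
Next Obligation. by move=> f v x y; rewrite /= raddfB opprD. Qed.
Next Obligation. by move=> f u v g x; rewrite /= rhom_natural raddfN. Qed.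

Program Definition rhom_add (f g : rhom M N) : rhom M N :=
  RHom (rhom_at := fun v x => f v x + g v x) _ _.
Next Obligation. by move=> f g v x y; rewrite /= !raddfB addrACA opprD. Qed.
Next Obligation. by move=> f g u v h x; rewrite /= !rhom_natural raddfD. Qed.

HB.instance Definition _ := gen_eqMixin (rhom M N).
HB.instance Definition _ := gen_choiceMixin (rhom M N).

Fact rhom_addA : associative rhom_add.
Proof. by move=> f g h; apply: rhomP => v x /=; rewrite addrA. Qed.
Fact rhom_addC : commutative rhom_add.
Proof. by move=> f g; apply: rhomP => v x /=; rewrite addrC. Qed.
Fact rhom_add0 : left_id rhom0 rhom_add.
Proof. by move=> f; apply: rhomP => v x /=; rewrite add0r. Qed.
Fact rhom_addN : left_inverse rhom0 rhom_opp rhom_add.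
Proof. by move=> f; apply: rhomP => v x /=; rewrite addNr. Qed.

HB.instance Definition _ :=
  GRing.isZmodule.Build (rhom M N) rhom_addA rhom_addC rhom_add0 rhom_addN.

End RHomZmodule.

Program Definition rhom_comp L (M N Q : rmodule L) (g : rhom N Q)
  (f : rhom M N) : rhom M Q := RHom (rhom_at := fun v x => g v (f v x)) _ _.
Next Obligation. by move=> L M N Q g f v x y; rewrite /= !raddfB. Qed.
Next Obligation. by move=> L M N Q g f u v h x; rewrite /= !rhom_natural. Qed.

(* The type [chain n v] is the set of composable n-tuples of morphisms with   *)
(* source v; it is built by adding morphisms on the right. For n = 0 it has a *)
(* single element, the object v itself.                                       *)

Fixpoint chain (L : smallCategory) (n : nat) (w : L) : Type :=
  match n with
  | 0 => unit
  | m.+1 => {v : L & chain m v & mor v w}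
  end.

Definition crcons (L : smallCategory) n (v w : L) (p : chain n v)
  (f : mor v w) : chain n.+1 w := existT2 _ _ v p f.

Variant crcons_spec (L : smallCategory) n (w : L) : chain n.+1 w -> Type :=
  CrconsSpec v (p : chain n v) (f : mor v w) : crcons_spec (crcons p f).

Lemma crconsP (L : smallCategory) n (w : L) (x : chain n.+1 w) : crcons_spec x.
Proof. by case: x => v p f; apply: (CrconsSpec p f). Qed.

(* [(f_0, ..., f_n) |-> (f_1, ..., f_n)], and [f_0 |-> s(f_0)] for n = 0 *)
Fixpoint cbehead (L : smallCategory) n : forall w : L, chain n.+1 w -> chain n w :=
  match n with
  | 0 => fun w _ => tt
  | m.+1 => fun w x => let: existT2 v p f := x in crcons (cbehead p) f
  end.

(* [(f_0, ..., f_n) |-> (f_0, ..., f_(i-1) f_i, ..., f_n)];                   *)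
(* only meaningful for 1 <= i <= n                                            *)
Fixpoint cmerge (L : smallCategory) (i n : nat) :
    forall w : L, chain n.+1 w -> chain n w :=
  match n with
  | 0 => fun w _ => tt
  | m.+1 => fun w x =>
    let: existT2 v p f := x in
    if i == m.+1 then let: existT2 u q g := p in crcons q (comp g f)
    else crcons (cmerge i p) f
  end.

(* [(f_0, ..., f_n) |-> (f_0, ..., f_(n-1), f_n g)] *)
Definition cmul_last (L : smallCategory) n (v w : L) (g : mor v w)
    (x : chain n.+1 v) : chain n.+1 w :=
  let: existT2 u p f := x in crcons p (comp f g).

Definition cface (L : smallCategory) (i n : nat) (w : L) (x : chain n.+1 w) :
  chain n w := if i == 0 then cbehead x else cmerge i x.

Lemma cface_rcons (L : smallCategory) i n (v w : L) (p : chain n.+1 v)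
    (f : mor v w) : (i <= n)%N -> cface i (crcons p f) = crcons (cface i p) f.
Proof. by rewrite /cface; case: i => //= i lt_in; rewrite eqSS ltn_eqF. Qed.

Lemma cface_last (L : smallCategory) n (u v w : L) (p : chain n u)
    (g : mor u v) (f : mor v w) :
  cface n.+1 (crcons (crcons p g) f) = crcons p (comp g f).
Proof. by rewrite /cface /= eqxx. Qed.

Lemma cfaceK (L : smallCategory) i j n (w : L) (x : chain n.+2 w) :
  (i < j)%N -> (j <= n.+1)%N -> cface i (cface j x) = cface j.-1 (cface i x).
Proof.
case: j => // j; elim: n i j w x => [|n IHn] i j w x.
  have chain0_eq (a b : chain 0 w) : a = b by case: a; case: b.
  by move=> _ _; apply: chain0_eq.
case: (crconsP x) => v p f; rewrite !ltnS [j.+1.-1]/= => le_ij.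
rewrite leq_eqVlt => /orP[/eqP def_j|]; last first.
  rewrite ltnS => le_jn; have le_in := leq_trans le_ij le_jn.
  by rewrite !cface_rcons ?IHn // ltnW.
case: (crconsP p) => u q g; subst j.
rewrite cface_last (cface_rcons _ f le_ij).
move: le_ij; rewrite leq_eqVlt => /orP[/eqP-> | lt_in]; last first.
  by rewrite !(@cface_rcons _ i n) ?cface_last.
by case: (crconsP q) => t r h; rewrite !cface_last compA.
Qed.

Lemma alt_sum_faces0 (V : zmodType) m (F : nat -> nat -> V) :
    (forall i j, (i < j)%N -> (j <= m.+1)%N -> F i j = F j.-1 i) ->
  \sum_(j < m.+2) \sum_(i < m.+1) F i j *~ (-1) ^+ i *~ (-1) ^+ j = 0.
Proof.
move=> FK; pose G i j := F i j *~ (-1) ^+ i *~ (-1) ^+ j.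
have -> : \sum_(j < m.+2) \sum_(i < m.+1) F i j *~ (-1) ^+ i *~ (-1) ^+ j =
    \sum_(j < m.+2) \sum_(i < m.+1 | (i < j)%N) G i j
    + \sum_(j < m.+2) \sum_(i < m.+1 | (j <= i)%N) G i j.
  rewrite -big_split; apply: eq_bigr => j _ /=.
  rewrite (bigID (fun i : 'I_m.+1 => (i < j)%N)) /=; congr (_ + _).
  by apply: eq_bigl => i; rewrite -leqNgt.
rewrite big_ord_recl big_pred0 // add0r.
rewrite [X in _ + X](exchange_big_dep xpredT) //= -big_split big1 //= => b _.
rewrite [X in _ + X]big_mkcond big_ord_recr /= leqNgt ltn_ord /= addr0.
rewrite -big_mkcond /= /bump /= add1n -big_split big1 //= => a le_ab.
rewrite /G (FK a b.+1) ?ltn_ord //= exprS mulN1r mulrNz.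
by rewrite -!mulrzA [(-1) ^+ a * _]mulrC addNr.
Qed.

Implicit Type L : smallCategory.

(* [freeg] needs a choiceType of generators; [{classic T}] provides one for an *)
(* arbitrary type T.                                                          *)
Notation freeAb T := {freeg {classic T}}.

Definition freeAb_gen (T : Type) (x : T) : freeAb T := << (x : {classic T}) >>.

Definition freeAb_lift (T U : Type) (h : T -> freeAb U) : freeAb T -> freeAb U :=
  fglift (h : {classic T} -> freeAb U).

Fact freeAb_lift_zmod_morphism T U (h : T -> freeAb U) :
  zmod_morphism (freeAb_lift h).
Proof. exact: lift_is_additive. Qed.

HB.instance Definition _ T U (h : T -> freeAb U) :=
  GRing.isZmodMorphism.Build (freeAb T) (freeAb U) (freeAb_lift h)
    (freeAb_lift_zmod_morphism h).

Lemma freeAb_lift_gen T U (h : T -> freeAb U) (x : T) :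
  freeAb_lift h (freeAb_gen x) = h x.
Proof. by rewrite /freeAb_lift /freeAb_gen liftU scale1r. Qed.

Lemma freeAb_ext T (V : zmodType) (f g : {additive freeAb T -> V}) :
  (forall x : T, f (freeAb_gen x) = g (freeAb_gen x)) -> f =1 g.
Proof.
move=> fg D; rewrite -[D]freeg_sumE !raddf_sum; apply: eq_bigr => x _.
have -> : << coeff x D *g x >> = freeAb_gen (x : T) *~ coeff x D.
  by rewrite freeg_mulz intz.
by rewrite !raddfMz fg.
Qed.

Definition P_act L n (u v : L) (f : mor u v) :
    freeAb (chain n.+1 u) -> freeAb (chain n.+1 v) :=
  freeAb_lift (fun x => freeAb_gen (cmul_last f x)).

Lemma P_act_gen L n (u v : L) (f : mor u v) (x : chain n.+1 u) :
  P_act f (freeAb_gen x) = freeAb_gen (cmul_last f x).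
Proof. exact: freeAb_lift_gen. Qed.

HB.instance Definition _ L n (u v : L) (f : mor u v) :=
  GRing.isZmodMorphism.Build (freeAb (chain n.+1 u)) (freeAb (chain n.+1 v))
    (P_act f) (freeAb_lift_zmod_morphism _).

Fact P_act1 L n (v : L) x : P_act (n := n) (idm v) x = x.
Proof.
apply: (freeAb_ext (f := P_act (idm v)) (g := idfun)) => {}x.
rewrite -[LHS]/(P_act _ _) -[RHS]/(freeAb_gen x) P_act_gen; congr freeAb_gen.
by case: (crconsP x) => u p f; rewrite /= compm1.
Qed.

Fact P_actM L n (u v w : L) (f : mor u v) (g : mor v w) x :
  P_act (n := n) (comp f g) x = P_act g (P_act f x).
Proof.
apply: (freeAb_ext (f := P_act (comp f g)) (g := P_act g \o P_act f)) => {}x.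
rewrite -[LHS]/(P_act _ _) -[RHS]/(P_act g (P_act f _)) !P_act_gen.
congr freeAb_gen.
by case: (crconsP x) => t p h; rewrite /= compA.
Qed.

(* The generators of P^n_v are the (n+1)-tuples (f_0, ..., f_n), s(f_n) = v.  *)
Definition P (L : smallCategory) (n : nat) : rmodule L :=
  RModule (rmod_at := fun v => freeAb (chain n.+1 v)) (act := @P_act L n)
    (fun u v f => freeAb_lift_zmod_morphism _) (@P_act1 L n) (@P_actM L n).

(* [P_diff_at] is d_(n+1), from P^(n+1) to P^n *)
Definition P_diff_at L n (v : L) : freeAb (chain n.+2 v) -> freeAb (chain n.+1 v) :=
  freeAb_lift (fun x => freeAb_gen (cbehead x) +
    \sum_(1 <= i < n.+2) freeAb_gen (cmerge i x) *~ (-1) ^+ i).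

HB.instance Definition _ L n (v : L) :=
  GRing.isZmodMorphism.Build (freeAb (chain n.+2 v)) (freeAb (chain n.+1 v))
    (@P_diff_at L n v) (freeAb_lift_zmod_morphism _).

Lemma cface_sum L n (w : L) (V : zmodType) (h : chain n w -> V) x :
  h (cbehead x) + \sum_(1 <= i < n.+1) h (cmerge i x) *~ (-1) ^+ i =
  \sum_(i < n.+1) h (cface i x) *~ (-1) ^+ i.
Proof.
rewrite big_ord_recl expr0 mulr1z; congr (_ + _).
by rewrite big_add1 big_mkord; apply: eq_bigr => i _.
Qed.

Lemma P_diff_at_gen L n (v : L) (x : chain n.+2 v) :
  P_diff_at (freeAb_gen x) =
  \sum_(i < n.+2) freeAb_gen (cface i x) *~ (-1) ^+ i.
Proof. by rewrite /P_diff_at freeAb_lift_gen cface_sum. Qed.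

Fact P_diff_natural L n (u v : L) (f : mor u v) x :
  P_diff_at (n := n) (P_act f x) = P_act f (P_diff_at x).
Proof.
apply: (freeAb_ext (f := @P_diff_at L n v \o P_act f)
                   (g := P_act f \o @P_diff_at L n u)) => {}x.
change (P_diff_at (P_act f (freeAb_gen x)) = P_act f (P_diff_at (freeAb_gen x))).
rewrite P_act_gen !P_diff_at_gen raddf_sum.
apply: eq_bigr => -[i lt_in] _; rewrite raddfMz [nat_of_ord _]/=.
congr (_ *~ _); rewrite -[RHS]/(P_act f _) P_act_gen; congr freeAb_gen.
case: (crconsP x) => t p g; rewrite -/(crcons p (comp g f)).
move: lt_in; rewrite ltnS leq_eqVlt => /orP[/eqP-> | lt_in].
  by case: (crconsP p) => s q h; rewrite /= !cface_last /= compA.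
by rewrite !cface_rcons.
Qed.

Definition P_diff L n : rhom (P L n.+1) (P L n) :=
  @RHom L (P L n.+1) (P L n) (@P_diff_at L n) (fun v => freeAb_lift_zmod_morphism _)
    (@P_diff_natural L n).

Lemma P_diffK L n v (x : P L n.+2 v) : P_diff L n v (P_diff L n.+1 v x) = 0.
Proof.
apply: (freeAb_ext (f := @P_diff_at L n v \o @P_diff_at L n.+1 v)
                   (g := \0)) => {}x.
change (P_diff_at (P_diff_at (freeAb_gen x)) = 0).
rewrite P_diff_at_gen raddf_sum.
rewrite -[RHS](@alt_sum_faces0 _ n.+1
  (fun i j => freeAb_gen (cface i (cface j x)))).
  apply: eq_bigr => j _; rewrite raddfMz -[X in X *~ _]/(P_diff_at _).
  by rewrite P_diff_at_gen mulrz_suml.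
by move=> i j ij jn; rewrite cfaceK.
Qed.

Definition hom_diff L (A : rmodule L) n (f : rhom (P L n) A) :
  rhom (P L n.+1) A := rhom_comp f (P_diff L n).

Fact hom_diff_zmod_morphism L (A : rmodule L) n :
  zmod_morphism (@hom_diff L A n).
Proof. by move=> f g; apply: rhomP. Qed.

Fact hom_diffK L (A : rmodule L) n (f : rhom (P L n) A) :
  hom_diff (hom_diff f) = 0.
Proof.
apply: rhomP => v x.
by rewrite -[LHS]/(f v (P_diff L n v (P_diff L n.+1 v x))) P_diffK raddf0.
Qed.

Definition hom_complex L (A : rmodule L) : cochainComplex :=
  CochainComplex (coch := fun n => rhom (P L n) A)
    (@hom_diff_zmod_morphism L A) (@hom_diffK L A).

Definition ccochain L (A : rmodule L) n : Type := forall w : L, chain n w -> A w.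

Section CCochainZmodule.
Variables (L : smallCategory) (A : rmodule L) (n : nat).
Implicit Types c : ccochain A n.

Lemma ccochainP c c' : (forall w x, c w x = c' w x) -> c = c'.
Proof.
by move=> cc'; apply: functional_extensionality_dep => w;
   apply: functional_extensionality_dep => x.
Qed.

HB.instance Definition _ := gen_eqMixin (ccochain A n).
HB.instance Definition _ := gen_choiceMixin (ccochain A n).

Definition ccochain0 : ccochain A n := fun w x => 0.
Definition ccochain_opp c : ccochain A n := fun w x => - c w x.
Definition ccochain_add c c' : ccochain A n := fun w x => c w x + c' w x.

Fact ccochain_addA : associative ccochain_add.
Proof. by move=> c d e; apply: ccochainP => w x; apply: addrA. Qed.
Fact ccochain_addC : commutative ccochain_add.
Proof. by move=> c d; apply: ccochainP => w x; apply: addrC. Qed.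
Fact ccochain_add0 : left_id ccochain0 ccochain_add.
Proof. by move=> c; apply: ccochainP => w x; apply: add0r. Qed.
Fact ccochain_addN : left_inverse ccochain0 ccochain_opp ccochain_add.
Proof. by move=> c; apply: ccochainP => w x; apply: addNr. Qed.

HB.instance Definition _ := GRing.isZmodule.Build (ccochain A n)
  ccochain_addA ccochain_addC ccochain_add0 ccochain_addN.

End CCochainZmodule.

Definition act_last L (A : rmodule L) n (c : ccochain A n) (w : L)
    (x : chain n.+1 w) : A w :=
  let: existT2 v p f := x in act f (c v p).

(* The last sign (-1)^(n-1) is written (-1)^(n+1), so that the formula also   *)
(* covers n = 0, where it reads c(s(f)) - A(f)(c(r(f))).                      *)
Definition cat_diff L (A : rmodule L) n (c : ccochain A n) : ccochain A n.+1 :=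
  fun w x => c w (cbehead x)
    + \sum_(1 <= i < n.+1) c w (cmerge i x) *~ (-1) ^+ i
    + act_last c x *~ (-1) ^+ n.+1.

Definition ccoface L (A : rmodule L) (i n : nat) (c : ccochain A n) :
    ccochain A n.+1 :=
  fun w x => if (i <= n)%N then c w (cface i x) else act_last c x.

Lemma cat_diffE L (A : rmodule L) n (c : ccochain A n) w (x : chain n.+1 w) :
  cat_diff c x = \sum_(i < n.+2) ccoface i c x *~ (-1) ^+ i.
Proof.
rewrite /cat_diff cface_sum [RHS]big_ord_recr [RHS]/=; congr (_ + _).
  by apply: eq_bigr => i _; rewrite /ccoface -ltnS ltn_ord.
by rewrite /ccoface ltnn.
Qed.

Lemma ccofaceB L (A : rmodule L) i n (c c' : ccochain A n) w
    (x : chain n.+1 w) :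
  ccoface i (c - c') x = ccoface i c x - ccoface i c' x.
Proof.
rewrite /ccoface; case: leqP => _ //.
case: (crconsP x) => v p f.
exact: (raddfB (act f)).
Qed.

Lemma ccofaceK L (A : rmodule L) i j n (c : ccochain A n) w
    (x : chain n.+2 w) : (i < j)%N -> (j <= n.+2)%N ->
  ccoface j (ccoface i c) x = ccoface i (ccoface j.-1 c) x.
Proof.
case: j => // j; rewrite !ltnS [j.+1.-1]/= => le_ij.
rewrite leq_eqVlt => /orP[/eqP def_j|]; last first.
  rewrite ltnS => le_jn; have le_in := leq_trans le_ij le_jn.
  by rewrite /ccoface !ltnS le_jn le_in (leqW le_in) cfaceK.
subst j; case: (crconsP x) => v p f.
rewrite /ccoface !ltnn le_ij [LHS]/=.
move: le_ij; rewrite leq_eqVlt => /orP[/eqP-> | lt_in].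
  by case: (crconsP p) => u q g; rewrite ltnn cface_last /= actM.
by rewrite -ltnS lt_in cface_rcons.
Qed.

Fact cat_diff_zmod_morphism L (A : rmodule L) n :
  zmod_morphism (@cat_diff L A n).
Proof.
move=> c c'; apply: ccochainP => w x.
rewrite -[RHS]/(cat_diff c x - cat_diff c' x) !cat_diffE -sumrB.
by apply: eq_bigr => i _; rewrite ccofaceB mulrzBl.
Qed.

Fact cat_diffK L (A : rmodule L) n (c : ccochain A n) :
  cat_diff (cat_diff c) = 0.
Proof.
apply: ccochainP => w x; rewrite cat_diffE -[RHS]/(0 : A w).
rewrite -[RHS](@alt_sum_faces0 _ n.+1
  (fun i j => ccoface j (ccoface i c) x)).
  apply: eq_bigr => j _; rewrite -mulrz_suml; congr (_ *~ _).
  rewrite /ccoface; case: leqP => _; first by rewrite cat_diffE.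
  case: (crconsP x) => v p f; rewrite /= cat_diffE raddf_sum.
  by apply: eq_bigr => i _; rewrite raddfMz.
by move=> i j ij jn; rewrite ccofaceK.
Qed.

Definition cat_complex L (A : rmodule L) : cochainComplex :=
  CochainComplex (coch := fun n => ccochain A n)
    (@cat_diff_zmod_morphism L A) (@cat_diffK L A).

(* The generator is [f_1, ..., f_n, s(f_n)] for p = (f_1, ..., f_n), and for  *)
(* n = 0 it is [w], the object w being identified with its identity morphism. *)
Definition zeta L (A : rmodule L) n (f : hom_complex A n) : cat_complex A n :=
  fun w p => f w (freeAb_gen (crcons p (idm w))).

(* Main.v *)
Require Import Defs.
From mathcomp Require Import all_boot all_order all_algebra.
From mathcomp Require Import boolp.
From HB Require Import structures.
From mathcomp Require Import freeg.

Import GRing.Theory.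
Local Open Scope ring_scope.
Local Open Scope quotient_scope.

Set Implicit Arguments.
Unset Strict Implicit.
Unset Printing Implicit Defensive.

(** Already at the level of cochains, each [zeta] is an isomorphism, so no
    homological algebra beyond functoriality of cohomology is involved.

    The point is that [P^n] is a free module, in the sense that an element of
    [Hom(P^n, A)] amounts to an arbitrary choice of values on the generators
    whose last entry is an identity.  Indeed
    [[l_1, ..., l_n, l]] is the image of [[l_1, ..., l_n, s(l_n)]] under the
    action of [l], so naturality forces
    [f [l_1, ..., l_n, l] = A(l) ((zeta f) (l_1, ..., l_n))],
    and conversely this formula defines a natural map for any cochain
    (lemmas [unzetaK] and [zetaK]).

    That [zeta] commutes with the differentials is a comparison of faces.  In
    [d [l_0, ..., l_n, s(l_n)]] the faces [0, ..., n] leave the final identity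
    alone and give the faces of [(l_0, ..., l_n)]; the last face multiplies
    [l_n] by the identity, and its value [f [l_0, ..., l_n]] is the term
    [A(l_n) ((zeta f) (l_0, ..., l_(n-1)))] by naturality (lemma [zeta_diff]). *)

Lemma cohomology_classP (K : cochainComplex) n (x y : cocycle K n) :
  cohomology_class x = cohomology_class y <->
  is_coboundary (cocycle_val x - cocycle_val y).
Proof.
split=> [/eqP | bxy].
  by rewrite /cohomology_class -Quotient.idealrBE => /asboolP.
by apply/eqP; rewrite /cohomology_class -Quotient.idealrBE; apply/asboolP.
Qed.

Lemma cohomology_class_surj (K : cochainComplex) n (x : cohomology K n) :
  exists z : cocycle K n, x = cohomology_class z.
Proof. by elim/quotW: x => z; exists z. Qed.

Lemma cohomology_classB (K : cochainComplex) n :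
  zmod_morphism (@cohomology_class K n).
Proof. by move=> x y; rewrite /cohomology_class [LHS]raddfB. Qed.

Record cochainMap (K K' : cochainComplex) := CochainMap {
  cmap :> forall n, K n -> K' n;
  cmap_zmod_morphism : forall n, zmod_morphism (@cmap n);
  cmap_diff : forall n x, cdiff (@cmap n x) = @cmap n.+1 (cdiff x)
}.

HB.instance Definition _ K K' (phi : cochainMap K K') n :=
  GRing.isZmodMorphism.Build (K n) (K' n) (@cmap K K' phi n)
    (cmap_zmod_morphism phi (n := n)).

Section CohomologyMap.
Variables (K K' : cochainComplex) (phi : cochainMap K K') (n : nat).

Fact cmap_cocycle (z : cocycle K n) : phi n z \in @cocycles K' n.
Proof.
by case: z => x /=; rewrite !inE => /eqP dx; rewrite cmap_diff dx raddf0.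
Qed.

Definition cocycle_map (z : cocycle K n) : cocycle K' n :=
  Cocycle (cmap_cocycle z).

Lemma cocycle_map_zmod_morphism : zmod_morphism cocycle_map.
Proof. by move=> x y; apply: val_inj; rewrite /= !raddfB. Qed.

Lemma cmap_coboundary (x : K n) : is_coboundary x -> is_coboundary (phi n x).
Proof.
case: n x => [|m] x /=; first by move->; rewrite raddf0.
by case=> y <-; exists (phi m y); rewrite cmap_diff.
Qed.

Definition cohomology_map (x : cohomology K n) : cohomology K' n :=
  cohomology_class (cocycle_map (repr x)).

(** The chosen representative is immaterial, since a cochain map preserves
    coboundaries. *)
Lemma cohomology_mapE (z : cocycle K n) :
  cohomology_map (cohomology_class z) = cohomology_class (cocycle_map z).
Proof.
apply/cohomology_classP; rewrite /= -raddfB; apply: cmap_coboundary.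
by apply/cohomology_classP; rewrite /cohomology_class reprK.
Qed.

Lemma cohomology_map_zmod_morphism : zmod_morphism cohomology_map.
Proof.
move=> x y; have [u ->] := cohomology_class_surj x.
have [v ->] := cohomology_class_surj y.
by rewrite -cohomology_classB !cohomology_mapE cocycle_map_zmod_morphism
           cohomology_classB.
Qed.

HB.instance Definition _ :=
  GRing.isZmodMorphism.Build (cohomology K n) (cohomology K' n)
    cohomology_map cohomology_map_zmod_morphism.

End CohomologyMap.

Arguments cohomology_map {K K'} phi n x.

Lemma cohomology_mapK (K K' : cochainComplex) (phi : cochainMap K K')
    (psi : cochainMap K' K) n :
  cancel (phi n) (psi n) -> cancel (cohomology_map phi n) (cohomology_map psi n).
Proof.
move=> phiK x; have [z ->] := cohomology_class_surj x.
rewrite !cohomology_mapE; congr cohomology_class.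
by apply: val_inj; rewrite /= phiK.
Qed.

(** An additive inverse in each degree automatically respects the
    differentials, so a degreewise bijective cochain map is invertible. *)
Lemma cohomology_map_bij (K K' : cochainComplex) (phi : cochainMap K K')
    (psi : forall n, K' n -> K n) :
    (forall n, cancel (phi n) (psi n)) -> (forall n, cancel (psi n) (phi n)) ->
  forall n, bijective (cohomology_map phi n).
Proof.
move=> phiK psiK n.
have psiB m : zmod_morphism (psi m).
  by move=> x y; apply: (can_inj (phiK m)); rewrite raddfB /= !psiK.
have psid m (x : K' m) : cdiff (psi m x) = psi m.+1 (cdiff x).
  by apply: (can_inj (phiK m.+1)); rewrite -cmap_diff !psiK.
by exists (cohomology_map (CochainMap psiB psid) n); apply: cohomology_mapK.
Qed.

Section FreeAbEval.
Variables (T : Type) (V : zmodType) (h : T -> V).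

(** Linear extension is available for modules over the ring of coefficients,
    hence the detour through [zmodule V], which is [V] seen as a module over
    the integers. *)
Definition freeAb_eval : freeAb T -> V :=
  fglift (h : {classic T} -> zmodule V).

Fact freeAb_eval_zmod_morphism : zmod_morphism freeAb_eval.
Proof.
move=> x y; exact: (lift_is_additive (h : {classic T} -> zmodule V) x y).
Qed.

HB.instance Definition _ :=
  GRing.isZmodMorphism.Build (freeAb T) V freeAb_eval freeAb_eval_zmod_morphism.

Lemma freeAb_eval_gen (x : T) : freeAb_eval (freeAb_gen x) = h x.
Proof. by rewrite /freeAb_eval /freeAb_gen liftU scale1r. Qed.

End FreeAbEval.

Section Zeta.
Variables (L : smallCategory) (A : rmodule L).

Lemma zeta_zmod_morphism n : zmod_morphism (@zeta L A n).
Proof. by move=> f g; apply: ccochainP. Qed.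

(** A generator with last entry [g] is the image under [g] of the generator
    that ends in an identity instead, so naturality leaves only the values
    recorded by [zeta f] free. *)
Lemma zeta_act_last n (f : hom_complex A n) w (x : chain n.+1 w) :
  f w (freeAb_gen x) = act_last (zeta f) x.
Proof.
case: (crconsP x) => v p g; rewrite [RHS]/= /zeta.
rewrite -[RHS](rhom_natural f g (freeAb_gen (crcons p (idm v)) : P L n v)).
by rewrite -[act _ _]/(P_act g _) P_act_gen /= comp1m.
Qed.

Lemma zeta_diff n (f : hom_complex A n) : cdiff (zeta f) = zeta (cdiff f).
Proof.
apply: ccochainP => w x.
rewrite -[LHS]/(cat_diff (zeta f) x) cat_diffE.
rewrite -[RHS]/(f w (P_diff_at (freeAb_gen (crcons x (idm w))))).
rewrite P_diff_at_gen raddf_sum; apply: eq_bigr => -[i /= lt_in] _.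
rewrite raddfMz; congr (_ *~ _).
rewrite /ccoface; case: leqP => [le_in | lt_ni].
  by rewrite cface_rcons.
have {lt_in lt_ni} -> : i = n.+1 by apply/eqP; rewrite eqn_leq lt_ni andbT.
(* The last face absorbs the final identity into the last entry of [x]. *)
case: (crconsP x) => v p g; rewrite cface_last compm1.
by rewrite [RHS]zeta_act_last.
Qed.

Definition zeta_map : cochainMap (hom_complex A) (cat_complex A) :=
  CochainMap zeta_zmod_morphism zeta_diff.

Definition unzeta_at n (c : ccochain A n) v : P L n v -> A v :=
  freeAb_eval (@act_last L A n c v).

Fact unzeta_natural n (c : ccochain A n) u v (f : mor u v) (x : P L n u) :
  unzeta_at c (act f x) = act f (unzeta_at c x).
Proof.
apply: (freeAb_ext (f := freeAb_eval (@act_last L A n c v) \o P_act f)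
                   (g := act f \o freeAb_eval (@act_last L A n c u))) => {}x.
rewrite -[LHS]/(freeAb_eval _ (P_act f _)) -[RHS]/(act f (freeAb_eval _ _)).
rewrite P_act_gen !freeAb_eval_gen.
by case: (crconsP x) => t p g; rewrite /= actM.
Qed.

Definition unzeta n (c : cat_complex A n) : hom_complex A n :=
  @RHom L (P L n) A (@unzeta_at n c) (fun v => freeAb_eval_zmod_morphism _)
    (unzeta_natural c).

Lemma unzetaK n : cancel (@zeta L A n) (@unzeta n).
Proof.
move=> f; apply: rhomP => v D.
rewrite -[LHS]/(freeAb_eval (@act_last L A n (zeta f) v) D).
apply: (@freeAb_ext _ _ (freeAb_eval (@act_last L A n (zeta f) v))
                      (f v : {additive P L n v -> A v})) => x.
by rewrite [RHS]zeta_act_last; apply: freeAb_eval_gen.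
Qed.

Lemma zetaK n : cancel (@unzeta n) (@zeta L A n).
Proof.
move=> c; apply: ccochainP => w p.
by rewrite /zeta /= /unzeta_at freeAb_eval_gen /= act1.
Qed.

End Zeta.

Theorem proposition2p8 (L : smallCategory) (A : rmodule L) :
  [/\ forall n, zmod_morphism (@zeta L A n),
      forall n (f : hom_complex A n), cdiff (zeta f) = zeta (cdiff f) &
      forall n : nat,
        exists Phi : {additive cohomology (hom_complex A) n ->
                               cohomology (cat_complex A) n},
          bijective Phi /\
          forall f : cocycle (hom_complex A) n,
            exists2 z : cocycle (cat_complex A) n,
              cocycle_val z = zeta (cocycle_val f) &
              Phi (cohomology_class f) = cohomology_class z].
Proof.
split; [exact: zeta_zmod_morphism | exact: zeta_diff | move=> n].
exists (cohomology_map (zeta_map A) n); split=> [|f].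
  exact: (@cohomology_map_bij _ _ (zeta_map A) _ (@unzetaK L A) (@zetaK L A) n).
by exists (cocycle_map (zeta_map A) f); last exact: cohomology_mapE.
Qed.
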